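(* Let $T=(\mathcal X,\mathcal E_T,w,r)$ be a finite weighted tree rooted at $r$ with induced distance $d_T$, and let $\mu,\nu$ be probability measures on $\mathcal X$. The matrix $\gamma_T$ produced by the tree-transport algorithm described in the context (run on $T,\mu,\nu$) is an optimal transport plan between $\mu$ and $\nu$ for the ground cost $d_T$. Moreover, for a given edge $e=\{u,u^+\}$ of $T$, if $\Xi_T(u)=\mu(T_u)-\nu(T_u)>0$ then $$\sum_{x\in T_u}\sum_{y\in T_u^c}\gamma_T(x,y)=\mu(T_u)-\nu(T_u)\quad\text{and}\quad \sum_{x\in T_u^c}\sum_{y\in T_u}\gamma_T(x,y)=0,$$ whereas if $\Xi_T(u)=\mu(T_u)-\nu(T_u)<0$ then $$\sum_{x\in T_u}\sum_{y\in T_u^c}\gamma_T(x,y)=0\quad\text{and}\quad \sum_{x\in T_u^c}\sum_{y\in T_u}\gamma_T(x,y)=\nu(T_u)-\mu(T_u).$$ (Here $T$, $\Xi_T$, $\mu$, $\nu$ are the initial data, before any update made by the algorithm.)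
   Context: $\mathcal X$ is a finite set and $T=(\mathcal X,\mathcal E_T,w,r)$ is a tree with vertex set $\mathcal X$, root $r$, and symmetric positive edge weights $w$; $d_T(x,y)$ is the $w$-length of the unique path $P_{x,y}$ from $x$ to $y$ in $T$ ($P_{x,y}$ is regarded as a set of edges). For $u\neq r$, $u^+$ is the parent of $u$ (the neighbour of $u$ on the path to $r$). $y\lesssim u$ means that $u$ lies on the path from $y$ to $r$ (including $y=u$). $T_u$ is the subtree rooted at $u$ with vertex set $\{y:y\lesssim u\}$, and $T_u^c$ is the complementary subtree on $\mathcal X\setminus T_u$, the two being joined by the edge $\{u,u^+\}$; $\mu(T_u)=\sum_{y\lesssim u}\mu(y)$, and similarly for $\nu$. A leaf is a vertex without children. $\Pi(\mu,\nu)$ is the set of probability measures on $\mathcal X\times\mathcal X$ with first marginal $\mu$ and second marginal $\nu$; an optimal transport plan for the ground cost $d_T$ is a minimizer of $\sum_{x,y}d_T(x,y)\gamma(x,y)$ over $\gamma\in\Pi(\mu,\nu)$. Tree-transport algorithm. It maintains a matrix $\gamma_T$, a current tree $T$, a function $\xi:\mathcal X\to\mathbb R$, and the cumulative function $\Xi_T(v)=\sum_{y\lesssim v}\xi(y)$. Here $\mathrm{Sgn}$ is the sign function with $\mathrm{Sgn}(0)=0$. Preprocessing: set $\gamma_T=0$ on $\mathcal X\times\mathcal X$, then $\gamma_T(x,x)\leftarrow\min\{\mu(x),\nu(x)\}$ for all $x$, and $\xi\leftarrow\mu-\nu$ (so that initially $\Xi_T(u)=\mu(T_u)-\nu(T_u)$).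 Main loop: while there exists a leaf $x$ of $T$ with $\xi(x)\neq0$, do the following. (1) Pick such a leaf $x$ and set $m=|\xi(x)|$, $u_-=x$, $u=x^+$. (2) While $\mathrm{Sgn}(\Xi_T(u)-\Xi_T(u_-))=\mathrm{Sgn}(\xi(x))$ and $\Xi_T(u)\neq0$: set $m=\min\{m,|\Xi_T(u)|\}$, then $u_-\leftarrow u$ and $u\leftarrow u^+$. (3) Find a vertex $y$ nearest to $u$ in the subtree $T_u$ such that $\mathrm{Sgn}(\xi(x))\neq\mathrm{Sgn}(\xi(y))$, $\xi(y)\neq0$, and $\mathrm{Sgn}(\Xi_T(v))=-\mathrm{Sgn}(\xi(x))$ for every edge $\{v^+,v\}$ on the path $P_{u,y}$ from $u$ to $y$. (4) Let $m_{u,y}=\min_{\{v^+,v\}\in P_{u,y}}|\Xi_T(v)|$ (taken as $+\infty$ if $y=u$) and $m=\min\{m,m_{u,y},|\xi(y)|\}$. (5) If $\xi(x)>0$: $\gamma_T(x,y)\leftarrow\gamma_T(x,y)+m$, $\xi(x)\leftarrow\xi(x)-m$, $\xi(y)\leftarrow\xi(y)+m$. Otherwise: $\gamma_T(y,x)\leftarrow\gamma_T(y,x)+m$, $\xi(x)\leftarrow\xi(x)+m$, $\xi(y)\leftarrow\xi(y)-m$. (6) If $\xi(x)=0$, remove $x$ from $T$. If $\xi(y)=0$ and $y$ is a leaf of $T$, remove $y$ from $T$. (7) Update $\Xi_T$ according to the new $\xi$. Output: $\gamma_T$.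
   Formalization: The algorithm as described can stop early or get stuck (path r-a-b with μ-ν=(-1,1,0) or (-1,0,1)). Two rules are added: in step (2) the climb goes on while step (3) would have no candidate y, and when every leaf has ξ=0, leaves are removed and the loop goes on until T is empty. *)

(* Defs.v *)
From mathcomp Require Import all_boot all_order all_algebra.

Set Implicit Arguments.
Unset Strict Implicit.
Unset Printing Implicit Defensive.

Import Order.TTheory GRing.Theory Num.Theory.
Local Open Scope ring_scope.

Record wtree (R : realFieldType) (X : finType) := WTree {
  edge : rel X;
  weight : X -> X -> R;
  tree_root : X;
  edge_sym : symmetric edge;
  edge_irr : irreflexive edge;
  edge_connected : forall x y, connect edge x y;
  edge_acyclic : forall c : seq X, ucycle edge c -> (size c <= 2)%N;
  weight_sym : forall x y, weight x y = weight y x;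
  weight_gt0 : forall x y, edge x y -> 0 < weight x y
}.

Section Tree.
Variables (R : realFieldType) (X : finType) (T : wtree R X).
Implicit Types (x y u v : X) (V : {set X}).

(* The vertices of the simple path from x to y, without x. It has fewer than
   #|X| elements, so it is found by searching the finite type of bounded
   sequences; it is unique because T is a tree. *)
Definition tpath x y : seq X :=
  if [pick p : #|X|.-bseq X |
        [&& path (edge T) x p, last x p == y & uniq (x :: p)]] is Some p
  then p else [::].

(* The edges of P_{x,y}, each one oriented from x towards y. *)
Definition path_edges x y : seq (X * X) := zip (x :: tpath x y) (tpath x y).

Definition edge_on_path x y a b : bool :=
  ((a, b) \in path_edges x y) || ((b, a) \in path_edges x y).

Definition tdist x y : R := \sum_(a <- path_edges x y) weight T a.1 a.2.

(* u^+; by convention the parent of the root is the root itself. *)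
Definition parent u : X := head u (tpath u (tree_root T)).

(* y \lesssim u *)
Definition below y u : bool := u \in y :: tpath y (tree_root T).

Definition subtree u : {set X} := [set y | below y u].

(* The vertices v such that {v^+, v} is an edge of P_{x,y}. *)
Definition lower_ends x y : {set X} :=
  [set v | (v != tree_root T) && edge_on_path x y (parent v) v].

(* The trees met by the algorithm are T minus some successively removed leaves;
   such a tree is represented by its vertex set V. *)
Definition is_leaf V x : bool :=
  (x \in V) && [forall v in V, (v != tree_root T) ==> (parent v != x)].

End Tree.

Section Transport.
Variables (R : realFieldType) (X : finType).

Definition is_prob (I : finType) (p : I -> R) : Prop :=
  (forall i, 0 <= p i) /\ \sum_i p i = 1.

Definition coupling (mu nu : X -> R) (gamma : X -> X -> R) : Prop :=
  [/\ is_prob (fun z : X * X => gamma z.1 z.2),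
      forall x, \sum_y gamma x y = mu x
    & forall y, \sum_x gamma x y = nu y].

Definition transport_cost (c : X -> X -> R) (gamma : X -> X -> R) : R :=
  \sum_x \sum_y c x y * gamma x y.

Definition optimal_plan (c : X -> X -> R) (mu nu : X -> R)
    (gamma : X -> X -> R) : Prop :=
  coupling mu nu gamma /\
  forall gamma', coupling mu nu gamma' ->
    transport_cost c gamma <= transport_cost c gamma'.

Definition mass (m : X -> R) (A : {set X}) : R := \sum_(x in A) m x.

End Transport.

Section Algorithm.
Variables (R : realFieldType) (X : finType) (T : wtree R X).

Record state := State {
  plan : X -> X -> R;
  cur : {set X};
  xi : X -> R
}.

Implicit Types (s : state) (x y u v um : X) (m : R).

Definition cur_subtree s u : {set X} := cur s :&: subtree T u.

Definition Xi s v : R := mass (xi s) (cur_subtree s v).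

Definition init (mu nu : X -> R) : state :=
  State (fun x y => if x == y then Num.min (mu x) (nu x) else 0)
        [set: X] (fun x => mu x - nu x).

(* The vertices of T_u that can exchange mass with the leaf x through u. *)
Definition candidates s x u : {set X} :=
  [set y in cur_subtree s u |
    [&& Num.sg (xi s x) != Num.sg (xi s y), xi s y != 0
      & [forall v in lower_ends T u y, Num.sg (Xi s v) == - Num.sg (xi s x)]]].

(* The climb from the leaf x goes on from u_- = um, u to u, u^+ as long as
   Sgn (Xi u - Xi u_-) = Sgn (xi x) and Xi u <> 0. With Sgn 0 = 0 this test
   alone may stop at a vertex u where no partner of x can be found in T_u, e.g.
   when xi vanishes on T_u except at x; the second disjunct makes the climb go
   on in that case, and changes nothing when a partner exists. *)
Definition climbs s x um u : bool :=
  ((Num.sg (Xi s u - Xi s um) == Num.sg (xi s x)) && (Xi s u != 0))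
  || (candidates s x u == set0).

(* climb s x m um u m' u' : the climbing loop, entered with the values m,
   u_- = um and u, exits with the values m' and u'. *)
Inductive climb s x : R -> X -> X -> R -> X -> Prop :=
| climb_exit m um u : ~~ climbs s x um u -> climb s x m um u m u
| climb_up m um u m' u' : climbs s x um u ->
    climb s x (Num.min m `|Xi s u|) u (parent T u) m' u' ->
    climb s x m um u m' u'.

Definition nearest s x u y : Prop :=
  y \in candidates s x u /\
  forall z, z \in candidates s x u -> tdist T u y <= tdist T u z.

(* min {m, m_{u,y}, |xi y|}, where m_{u,y}, the minimum of |Xi v| over the edges
   {v^+, v} of P_{u,y}, is +oo when y = u: the iterated minimum is then
   over the empty set. *)
Definition amount s m u y : R :=
  \big[Num.min/Num.min m `|xi s y|]_(v in lower_ends T u y) `|Xi s v|.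

Definition move s a b m : state :=
  State (fun z t => if (z == a) && (t == b) then plan s z t + m
                    else plan s z t)
        (cur s)
        (fun z => if z == a then xi s z - m
                  else if z == b then xi s z + m else xi s z).

Definition transfer s x y m : state :=
  if 0 < xi s x then move s x y m else move s y x m.

Definition remove s x : state := State (plan s) (cur s :\ x) (xi s).

Definition trim s x y : state :=
  let s1 := if xi s x == 0 then remove s x else s in
  if (xi s1 y == 0) && is_leaf T (cur s1) y then remove s1 y else s1.

(* step_transport is the body of the main loop, run while some leaf has xi <> 0.
   It never removes a vertex where xi = 0 from the start, or where xi vanished
   before it became a leaf; such leaves may hide vertices with xi <> 0, as on
   the path r - a - b with xi = (-1, 1, 0), and the loop would end too early.
   When only such leaves remain, step_discard removes them. *)
Inductive step s : state -> Prop :=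
| step_transport x m u y :
    is_leaf T (cur s) x -> xi s x != 0 ->
    climb s x `|xi s x| x (parent T x) m u ->
    nearest s x u y ->
    step s (trim (transfer s x y (amount s m u y)) x y)
| step_discard x :
    (forall z, is_leaf T (cur s) z -> xi s z = 0) ->
    is_leaf T (cur s) x ->
    step s (remove s x).

Inductive reachable (mu nu : X -> R) : state -> Prop :=
| reachable_init : reachable mu nu (init mu nu)
| reachable_step s s' :
    reachable mu nu s -> step s s' -> reachable mu nu s'.

Definition halted s : Prop := forall x, ~~ is_leaf T (cur s) x.

(* Whatever choices are made, no run is infinite and every run that has not
   halted can be continued. *)
Definition always_terminates (mu nu : X -> R) : Prop :=
  Acc (fun s' s => step s s') (init mu nu) /\
  forall s, reachable mu nu s -> halted s \/ exists s', step s s'.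

Definition tree_transport_output (mu nu : X -> R) (gamma : X -> X -> R) : Prop :=
  exists s, [/\ reachable mu nu s, halted s & gamma = plan s].

End Algorithm.

(* Main.v *)
(* The cost of a plan is the sum over the edges {v, v^+} of w times the mass
   carried across the edge in both directions, and the difference of these two
   masses is mu(T_v) - nu(T_v). A plan that crosses each edge in one direction
   only is therefore optimal, and its crossing masses are the claimed ones.

   Along a run, the excess Xi(v) moves from mu(T_v) - nu(T_v) towards 0 without
   changing sign: a transfer from x to y climbs through edges where Xi has the
   sign of xi(x), descends through edges where it has the opposite sign, and
   moves at most |Xi(v)| across each of them. The climb does not pass the root
   because a vertex u whose excess does not have the sign of xi(x) has a partner
   of x in its subtree. Each transfer makes some xi(z) or some Xi(v) vanish for
   good, hence termination. *)
Require Import Defs.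
From mathcomp Require Import all_boot all_order all_algebra.
From mathcomp Require Import lra.

Set Implicit Arguments.
Unset Strict Implicit.
Unset Printing Implicit Defensive.

Import Order.TTheory GRing.Theory Num.Theory.
Local Open Scope ring_scope.

(** * Paths, ancestors and separating edges in a rooted tree *)

Lemma mem_zip (A : eqType) (s t : seq A) a b :
  (a, b) \in zip s t -> (a \in s) && (b \in t).
Proof.
elim: s t => [|c s IH] [|d t] //=; rewrite !inE xpair_eqE.
by case/orP=> [/andP[-> ->//]|/IH/andP[-> ->]]; rewrite !orbT.
Qed.

Section TreePaths.
Variables (R : realFieldType) (X : finType) (T : wtree R X).
Implicit Types (x y z u v a b c : X) (p q : seq X).

Local Notation r := (tree_root T).
Local Notation e := (edge T).
Local Notation parent := (parent T).
Local Notation below := (below T).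

(* Two simple paths that leave x by different edges and meet again would close
   a cycle of length at least 3. *)
Lemma no_fork x p q :
  path e x p -> path e x q -> uniq (x :: p) -> uniq (x :: q) ->
  head x p != head x q -> ~~ has (mem q) p.
Proof.
rewrite !cons_uniq => pp pq /andP[xp up] /andP[xq uq] headP; apply/negP => hasc.
(* [c] is the first vertex of [p] that lies on [q], so the part [p1] before it avoids [q] and the
   closed walk below is simple. *)
case: (split_find hasc) pp xp up headP => c p1 p2 cq p1q pp xp up headP.
move: cq; rewrite inE => cq.
case/splitPr: cq pq xq uq headP p1q => q1 q2 pq xq uq headP p1q.
have := edge_acyclic (w := T) (c := x :: p1 ++ c :: rev q1); rewrite /ucycle.
have -> : cycle e (x :: p1 ++ c :: rev q1).
  rewrite /= rcons_cat cat_path /= -rev_cons.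
  move: pp pq; rewrite cat_rcons !cat_path /= => /and3P[-> -> _] /and3P[pq1 eqc _] /=.
  have := rev_path e x (rcons q1 c); rewrite last_rcons belast_rcons => ->.
  rewrite (@eq_path _ _ e) ?rcons_path ?pq1 // => u v /=.
  exact: edge_sym.
have -> : uniq (x :: p1 ++ c :: rev q1).
  rewrite /= mem_cat inE mem_rev cat_uniq /= mem_rev rev_uniq.
  move: xp xq; rewrite cat_rcons !mem_cat !inE !negb_or.
  move=> /and3P[-> -> _] /and3P[-> _ _] /=.
  move: up uq; rewrite cat_rcons !cat_uniq /=.
  move=> /andP[-> /andP[/norP[-> _] _]] /and3P[-> /norP[-> _] _] /=.
  rewrite andbT; apply/hasPn => z; rewrite mem_rev => zq1.
  by apply/negP => zp1; case/negP: p1q; apply/hasP; exists z => //=; rewrite mem_cat zq1.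
(* A cycle of at most two vertices would have [p1] and [q1] both empty, and then both paths would
   start with [c]. *)
move=> /(_ isT) /=; rewrite size_cat /= size_rev.
by move: headP; case: p1 {pp xp up p1q} => [|? ?]; case: q1 {pq xq uq} => [|? ?] //=;
  rewrite ?eqxx // !addnS.
Qed.

Lemma upath_inj x p q :
  path e x p -> path e x q -> uniq (x :: p) -> uniq (x :: q) ->
  last x p = last x q -> p = q.
Proof.
elim: p x q => [|a p IH] x [|b q] //.
- by move=> _ _ _ /andP[xq _] /= xE; rewrite xE mem_last in xq.
- by move=> _ _ /andP[xp _] _ /= xE; rewrite -xE mem_last in xp.
move=> pp pq up uq lastE.
have [ab|neq_ab] := eqVneq a b.
  move: pp pq up uq lastE => /= /andP[_ pp] /andP[_ pq] /andP[_ up] /andP[_ uq].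
  by rewrite -ab in pq uq * => lastE; rewrite (IH a q).
have /hasPn/(_ (last a p)) := no_fork pp pq up uq neq_ab.
by rewrite mem_last => /(_ isT)/negP[]; rewrite (lastE : last a p = last b q); exact: mem_last.
Qed.

(** The search in [tpath] cannot fail: connectedness gives a walk, shortening makes it simple, and a
    simple path has at most [#|X|] vertices, its start included. *)
Lemma tpathP x y :
  [/\ path e x (tpath T x y), last x (tpath T x y) = y & uniq (x :: tpath T x y)].
Proof.
rewrite /tpath; case: pickP => [p /and3P[? /eqP ? ?] // | none].
case/connectP: (edge_connected T x y) => p0 pp0 lastE.
case/shortenP: pp0 lastE => p pp up _ lastE.
have sp : (size p <= #|X|)%N.
  by rewrite ltnW // -[(size p).+1]/(size (x :: p)) -(card_uniqP up) max_card.
by have /negP[] := negbT (none (Bseq sp)); rewrite pp up lastE eqxx.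
Qed.

Lemma tpath_uniq x y p :
  path e x p -> last x p = y -> uniq (x :: p) -> tpath T x y = p.
Proof.
move=> pp lp up; have [pt lt ut] := tpathP x y.
by apply: (upath_inj pt pp ut up); rewrite lt.
Qed.

Lemma tpath_refl x : tpath T x x = [::].
Proof. exact: tpath_uniq. Qed.

Lemma tpath_root x : x != r -> tpath T x r = parent x :: tpath T (parent x) r.
Proof.
rewrite /Defs.parent; have [] := tpathP x r.
case: (tpath T x r) => [|a p] /= pp lp up; first by rewrite lp eqxx.
move=> _; congr (_ :: _); apply/esym/tpath_uniq => //; first by case/andP: pp.
by case/andP: up.
Qed.

Lemma parent_root : parent r = r.
Proof. by rewrite /Defs.parent tpath_refl. Qed.

Lemma edge_parent x : x != r -> e x (parent x).
Proof. by move=> xr; have [] := tpathP x r; rewrite tpath_root //= => /andP[]. Qed.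

Definition depth x := size (tpath T x r).

Lemma depth_parent x : x != r -> depth x = (depth (parent x)).+1.
Proof. by move=> xr; rewrite /depth tpath_root. Qed.

(** Induction on the depth, from the root downwards; most facts about [below] are proved this
    way. *)
Lemma parent_ind (P : X -> Prop) :
  P r -> (forall x, x != r -> P (parent x) -> P x) -> forall x, P x.
Proof.
move=> P0 PS x; move: {2}(depth x) (erefl (depth x)) => n.
elim: n x => [|n IH] x dx; have [->//|xr] := eqVneq x r.
  by move: dx; rewrite depth_parent.
by apply: PS => //; apply: IH; move: dx; rewrite depth_parent // => -[].
Qed.

(** If [b] lies on the path from [a] to the root, the edge is a shortcut and so must be its first
    step; otherwise prepending [b] to that path gives the path of [b]. *)
Lemma edge_parentP a b :
  e a b -> a != r /\ b = parent a \/ b != r /\ a = parent b.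
Proof.
move=> eab; have [pt lt ut] := tpathP a r.
have neq_ab : a != b by apply: contraTneq eab => ->; rewrite edge_irr.
have [bin|bnin] := boolP (b \in tpath T a r).
  left; move: pt lt ut.
  case/splitPr: bin => p1 p2; rewrite cat_path last_cat /=.
  move=> /and3P[_ _ pp2] lp2 /andP[]; rewrite mem_cat inE !negb_or.
  move=> /and3P[_ _ ap2]; rewrite cat_uniq => /and3P[_ _ ubp2].
  have tE : tpath T a r = b :: p2.
    by apply: tpath_uniq; rewrite // ?cons_uniq ?ubp2 ?inE ?negb_or ?neq_ab ?ap2 //= eab.
  split; last by rewrite /Defs.parent tE.
  by apply: contra_eq_neq tE => ->; rewrite tpath_refl.
right; have tE : tpath T b r = a :: tpath T a r.
  by apply: tpath_uniq; rewrite // ?(cons_uniq b) ?ut ?inE ?negb_or ?(eq_sym b) ?neq_ab ?bnin //= edge_sym eab.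
split; last by rewrite /Defs.parent tE.
by apply: contra_eq_neq tE => ->; rewrite tpath_refl.
Qed.

Lemma below_refl v : below v v.
Proof. exact: mem_head. Qed.

Lemma below_root_r x : below x r.
Proof. by have [_ lt _] := tpathP x r; have := mem_last x (tpath T x r); rewrite lt. Qed.

Lemma below_root_l v : below r v = (v == r).
Proof. by rewrite /Defs.below tpath_refl inE. Qed.

Lemma below_step x v : x != r -> below x v = (v == x) || below (parent x) v.
Proof. by move=> xr; rewrite /Defs.below tpath_root // inE. Qed.

Lemma below_parent x : below x (parent x).
Proof.
have [->|xr] := eqVneq x r; first by rewrite parent_root below_refl.
by rewrite below_step // below_refl orbT.
Qed.

Lemma below_trans y x z : below x y -> below y z -> below x z.
Proof.
move=> + yz; elim/parent_ind: x => [|x xr IH].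
  by rewrite below_root_l => /eqP <-.
by rewrite [below x y]below_step // => /orP[/eqP <-//|/IH xz]; rewrite below_step // xz orbT.
Qed.

Lemma below_total x u v : below x u -> below x v -> below u v || below v u.
Proof.
elim/parent_ind: x => [|x xr IH].
  by rewrite !below_root_l => /eqP-> /eqP->; rewrite below_refl.
rewrite (below_step u) // (below_step v) //.
move=> /orP[/eqP->|xu] /orP[/eqP->|xv]; last exact: IH.
- by rewrite below_refl.
- by rewrite (below_trans (below_parent x) xv).
- by rewrite (below_trans (below_parent x) xu) orbT.
Qed.

Lemma below_depth x v : below x v -> (depth v <= depth x)%N.
Proof.
elim/parent_ind: x => [|x xr IH]; first by rewrite below_root_l => /eqP->.
by rewrite below_step // => /orP[/eqP->//|/IH]; rewrite (depth_parent xr); exact: leqW.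
Qed.

Lemma parent_not_below x : x != r -> ~~ below (parent x) x.
Proof.
by move=> xr; apply/negP => /below_depth; rewrite (depth_parent xr) ltnn.
Qed.

Lemma below_antisym x y : below x y -> below y x -> x = y.
Proof.
move=> xy yx; apply/eqP; apply: contraTT xy => nxy.
have [xr|xr] := eqVneq x r; first by rewrite xr below_root_l -xr eq_sym.
rewrite below_step // eq_sym (negPf nxy) /=.
by apply: contraNN (parent_not_below xr) => /below_trans; exact.
Qed.

(** The subtrees of the children of [u] partition the strict descendants of [u]; the form as a count
    lets sums over subtrees be split by exchanging two sums. *)
Lemma sum_children_below y u :
  (\sum_(c | (c != r) && (parent c == u)) below y c)%N = (y != u) && below y u.
Proof.
elim/parent_ind: y => [|y yr IH].
  rewrite big1 => [|c /andP[/negPf cr _]]; last by rewrite below_root_l cr.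
  by rewrite below_root_l eq_sym; case: eqP.
(* A child of [u] above [y] is either [y] itself or above [parent y], and not both since [parent y]
   is not below [y]. *)
transitivity ((parent y == u) + ((parent y != u) && below (parent y) u))%N.
  rewrite -IH -[LHS]/(\sum_(c | _) _)%N.
  transitivity (\sum_(c | (c != r) && (parent c == u)) ((c == y) + below (parent y) c))%N.
    apply: eq_bigr => c _; rewrite below_step //.
    by case: eqVneq => [->|_] //=; rewrite (negPf (parent_not_below yr)).
  rewrite big_split /=; congr (_ + _)%N.
  rewrite -big_mkcondr /= ; case: eqVneq => [pyu|pyu].
    by rewrite (big_pred1 y) // => c /=; case: (eqVneq c y) => [->|_]; rewrite ?andbF ?yr ?pyu ?eqxx.
  by rewrite big_pred0 // => c; case: (eqVneq c y) => [->|_]; rewrite ?andbF ?yr ?(negPf pyu).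
have npy := parent_not_below yr; rewrite [below y u]below_step // [u == y]eq_sym.
have [yu|yu] /= := eqVneq y u; last by case: eqVneq => [->|_]; rewrite ?below_refl.
rewrite -yu (negPf npy) andbF; case: eqVneq => // pyy.
by rewrite pyy below_refl in npy.
Qed.

Lemma sum_below_children (f : X -> R) u :
  \sum_(y | below y u) f y =
  f u + \sum_(c | (c != r) && (parent c == u)) \sum_(y | below y c) f y.
Proof.
rewrite (bigD1 u) ?below_refl //=; congr (_ + _).
transitivity (\sum_y f y *+ (\sum_(c | (c != r) && (parent c == u)) below y c)%N).
  rewrite big_mkcond; apply: eq_bigr => y _.
  by rewrite sum_children_below andbC; case: ifP.
rewrite (eq_bigr _ (fun y _ => esym (sumrMnr (f y) _ _ _))) exchange_big; apply: eq_bigr => c _.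
by rewrite [RHS]big_mkcond; apply: eq_bigr => y _; case: ifP.
Qed.

(* For v other than the root, {v^+, v} separates x from y. *)
Definition separates x y v := below x v (+) below y v.

Lemma separates_sym x y v : separates x y v = separates y x v.
Proof. exact: addbC. Qed.

Lemma separates_trans y x z v :
  separates x z v = separates x y v (+) separates y z v.
Proof. by rewrite /separates -addbA addKb. Qed.

Lemma separates_parent x v : x != r -> separates x (parent x) v = (v == x).
Proof.
move=> xr; rewrite /separates below_step //.
case: eqVneq => [->|_] /=; last exact: addbb.
by rewrite (negPf (parent_not_below xr)).
Qed.

(** Every edge joins a vertex [x] to its parent, and this step changes membership in the subtree of
    [x] only. *)
Lemma edge_separates a b v : e a b -> v != r ->
  separates a b v = ((parent v, v) == (a, b)) || ((v, parent v) == (a, b)).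
Proof.
move=> + vr; have npv := parent_not_below vr; rewrite !xpair_eqE.
case/edge_parentP=> [] [cr ->]; last rewrite separates_sym.
  rewrite separates_parent //; case: eqVneq => [->|_]; first by rewrite eqxx orbT.
  rewrite orbF; apply/esym/negbTE; apply: contraNN npv => /andP[/eqP-> /eqP->].
  exact: below_parent.
rewrite separates_parent //; case: eqVneq => [->|_]; first by rewrite eqxx.
rewrite andbF; apply/esym/negbTE; apply: contraNN npv => /andP[/eqP-> /eqP->].
exact: below_parent.
Qed.

(** A simple path does not traverse its first edge again, so in the two inductions below exclusive
    and inclusive disjunction agree. *)
Lemma edge_path_disjoint a b x z p : x \notin z :: p ->
  ((a, b) == (x, z)) || ((b, a) == (x, z)) ->
  ((a, b) \in zip (z :: p) p) || ((b, a) \in zip (z :: p) p) = false.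
Proof.
move=> xp xz; apply: contraNF xp.
have sub c : c \in p -> c \in z :: p by rewrite inE orbC => ->.
by case/orP: xz => /eqP[<- _] /orP[] /mem_zip/andP[? ?] //; exact: sub.
Qed.

(** Separation is additive modulo 2 along a path, and a simple path uses each edge at most once. *)
Lemma separates_path x p v : path e x p -> uniq (x :: p) -> v != r ->
  separates x (last x p) v =
  ((parent v, v) \in zip (x :: p) p) || ((v, parent v) \in zip (x :: p) p).
Proof.
move=> + + vr; elim: p x => [|z p IH] x /=; first by rewrite /separates addbb.
move=> /andP[exz pp] /andP[xp up]; rewrite (separates_trans z) IH //.
have := @edge_path_disjoint (parent v) v _ _ _ xp.
rewrite edge_separates // !inE orbACA; case: (_ || _) => //= -> //.
Qed.

Lemma sum_path_weight x p : path e x p -> uniq (x :: p) ->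
  \sum_(a <- zip (x :: p) p) weight T a.1 a.2 =
  \sum_(v | v != r) weight T v (parent v) *+ separates x (last x p) v.
Proof.
elim: p x => [|z p IH] x.
  by move=> _ _; rewrite big_nil big1 // => v _; rewrite /separates addbb.
rewrite cons_uniq => /andP[exz pp] /andP[xp up].
have -> : zip [:: x, z & p] (z :: p) = (x, z) :: zip (z :: p) p by [].
rewrite big_cons IH //=.
have -> : weight T x z = \sum_(v | v != r) weight T v (parent v) *+ separates x z v.
  case/edge_parentP: exz => [] [cr ->].
    rewrite (bigD1 x) //= separates_parent // eqxx big1 ?addr0 // => v /andP[_ /negPf vx].
    by rewrite separates_parent // vx.
  rewrite (bigD1 z) //= separates_sym separates_parent // eqxx weight_sym.
  rewrite big1 ?addr0 // => v /andP[_ /negPf vz].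
  by rewrite separates_sym separates_parent // vz.
rewrite -big_split; apply: eq_bigr => v vr /=; rewrite -mulrnDr (separates_trans z x (last z p)).
have := @edge_path_disjoint (parent v) v _ _ _ xp.
by rewrite -edge_separates // -separates_path //; case: separates => //= ->.
Qed.

(** The decomposition of a tree metric into cut metrics, one for each edge; it turns the transport
    cost into a sum over edges. *)
Lemma tdistE x y :
  tdist T x y = \sum_(v | v != r) weight T v (parent v) *+ separates x y v.
Proof.
by have [pt lt ut] := tpathP x y; rewrite -[in RHS]lt -sum_path_weight.
Qed.

Lemma lower_endsE x y v : (v \in lower_ends T x y) = (v != r) && separates x y v.
Proof.
have [pt lt ut] := tpathP x y; rewrite inE; have [//|vr] /= := eqVneq v r.
by rewrite -[in RHS]lt separates_path.
Qed.

(** When [y] is below [u] the path only descends, so its edges lie above [y] and strictly under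
    [u]. *)
Lemma lower_ends_below u y v : below y u ->
  (v \in lower_ends T u y) = below y v && ~~ below u v.
Proof.
move=> yu; rewrite lower_endsE /separates.
have [->|_] := eqVneq v r; first by rewrite !below_root_r.
have [uv|] := boolP (below u v); last by rewrite andbT.
by rewrite (below_trans yu uv).
Qed.
End TreePaths.

(** * Mass crossing an edge, and a sufficient condition for optimality *)

Section Flows.
Variables (R : realFieldType) (X : finType) (T : wtree R X).
Implicit Types (x y v : X) (S : {set X}) (g : X -> X -> R).

Local Notation r := (tree_root T).

Definition flow g S S' : R := \sum_(x in S) \sum_(y in S') g x y.

Lemma flow_ge0 g S S' : (forall x y, 0 <= g x y) -> 0 <= flow g S S'.
Proof. by move=> g0; apply: sumr_ge0 => x _; apply: sumr_ge0. Qed.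

Lemma flow_setC g S :
  flow g S (~: S) + flow g (~: S) S =
  \sum_x \sum_y g x y *+ ((x \in S) (+) (y \in S)).
Proof.
rewrite [RHS](bigID (mem S)) /=; congr (_ + _).
  apply: eq_bigr => x xS; rewrite big_mkcond; apply: eq_bigr => y _.
  by rewrite xS inE; case: (y \in S).
apply: eq_big => [x|x]; rewrite ?inE // => /negPf xS.
by rewrite big_mkcond; apply: eq_bigr => y _; rewrite xS; case: (y \in S).
Qed.

(** The mass that stays inside [S] counts once in each marginal and cancels. *)
Lemma flow_balance (mu nu : X -> R) g S :
  (forall x, \sum_y g x y = mu x) -> (forall y, \sum_x g x y = nu y) ->
  flow g S (~: S) - flow g (~: S) S = mass mu S - mass nu S.
Proof.
move=> gmu gnu.
have -> : mass mu S = flow g S S + flow g S (~: S).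
  rewrite -big_split; apply: eq_bigr => x _ /=; rewrite -gmu (bigID (mem S)) /=.
  by congr (_ + _); apply: eq_bigl => y; rewrite inE.
have -> : mass nu S = flow g S S + flow g (~: S) S.
  rewrite [flow g S S]exchange_big [flow g (~: S) S]exchange_big -big_split.
  apply: eq_bigr => x _ /=; rewrite -gnu (bigID (mem S)) /=.
  by congr (_ + _); apply: eq_bigl => y; rewrite inE.
lra.
Qed.

Lemma transport_cost_tdist g :
  transport_cost (tdist T) g =
  \sum_(v | v != r) weight T v (parent T v) *
    (flow g (subtree T v) (~: subtree T v) + flow g (~: subtree T v) (subtree T v)).
Proof.
under [RHS]eq_bigr => v _.
  rewrite flow_setC mulr_sumr.
  under eq_bigr do rewrite mulr_sumr.
  over.
rewrite exchange_big; apply: eq_bigr => x _; rewrite exchange_big.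
apply: eq_bigr => y _; rewrite tdistE mulr_suml; apply: eq_bigr => v _.
by rewrite !inE mulrnAl mulrnAr.
Qed.

(* The cost is at least sum_v w(v) |mu(T_v) - nu(T_v)|, with equality when no
   edge carries mass in both directions. *)
Lemma one_way_optimal (mu nu : X -> R) g : coupling mu nu g ->
  (forall v, v != r ->
     flow g (subtree T v) (~: subtree T v) = 0 \/
     flow g (~: subtree T v) (subtree T v) = 0) ->
  optimal_plan (tdist T) mu nu g.
Proof.
move=> cg oneway; split=> // h [[h0 _] hmu hnu]; case: cg => [[g0 _] gmu gnu].
rewrite !transport_cost_tdist; apply: ler_sum => v vr.
apply: ler_wpM2l; first by rewrite ltW // weight_gt0 // edge_parent.
set S := subtree T v.
have := flow_balance S gmu gnu; rewrite -(flow_balance S hmu hnu).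
have : 0 <= flow h S (~: S) by apply: flow_ge0 => x y; exact: (h0 (x, y)).
have : 0 <= flow h (~: S) S by apply: flow_ge0 => x y; exact: (h0 (x, y)).
by case: (oneway v vr); rewrite -/S; lra.
Qed.
End Flows.

(** * The invariant of a run and the effect of one transfer *)

Section Run.
Variables (R : realFieldType) (X : finType) (T : wtree R X).
Variables (mu nu : X -> R).
Implicit Types (s : state R X) (x y u v um a b : X) (m : R).

Local Notation r := (tree_root T).
Local Notation parent := (parent T).
Local Notation below := (below T).
Local Notation subtree := (subtree T).

(** Unlike [Xi], this sums over the whole initial subtree, so removing leaves does not affect it;
    [Xi_excess] shows that the two agree during a run. *)
Definition excess s v : R := \sum_(y | below y v) xi s y.

Lemma excess_root s : excess s r = \sum_y xi s y.
Proof. by apply: eq_bigl => y; rewrite below_root_r. Qed.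

Lemma excess_rec s u :
  excess s u = xi s u + \sum_(c | (c != r) && (parent c == u)) excess s c.
Proof. exact: sum_below_children. Qed.

Lemma excess_init v :
  excess (init mu nu) v = mass mu (subtree v) - mass nu (subtree v).
Proof.
by rewrite /excess sumrB; congr (_ - _); apply: eq_bigl => y; rewrite inE.
Qed.

Local Notation imbalance := (excess (init mu nu)).

(** The marginals of the plan fall short of [mu] and [nu] by the positive and negative parts of
    [xi], hence become exact once [xi] vanishes. The last four fields say that the excess keeps its
    initial sign until it is zero, and that mass crosses an edge only in the direction of the
    initial imbalance. *)
Record inv s : Prop := Inv {
  inv_parent : forall v, v \in cur s -> parent v \in cur s;
  inv_supp : forall v, xi s v != 0 -> v \in cur s;
  inv_ge0 : forall x y, 0 <= plan s x y;
  inv_fst : forall x, \sum_y plan s x y = mu x - Num.max (xi s x) 0;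
  inv_snd : forall y, \sum_x plan s x y = nu y - Num.max (- xi s y) 0;
  inv_sum : \sum_x xi s x = 0;
  inv_pos : forall v, 0 < excess s v -> 0 < imbalance v;
  inv_neg : forall v, excess s v < 0 -> imbalance v < 0;
  inv_out : forall x y v, plan s x y != 0 ->
    below x v -> ~~ below y v -> 0 < imbalance v;
  inv_in : forall x y v, plan s x y != 0 ->
    below y v -> ~~ below x v -> imbalance v < 0 }.

Lemma inv_init : is_prob mu -> is_prob nu -> inv (init mu nu).
Proof.
move=> [mu0 mu1] [nu0 nu1]; split=> //=.
- by move=> x y; case: ifP => // _; rewrite le_min mu0 nu0.
- move=> x; rewrite (bigD1 x) //= eqxx big1 ?addr0; last first.
    by move=> y; rewrite eq_sym => /negPf->.
  by rewrite minEle maxEle; case: leP => ?; case: leP => ?; lra.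
- move=> x; rewrite (bigD1 x) //= eqxx big1 ?addr0; last first.
    by move=> y /negPf->.
  by rewrite minEle maxEle; case: leP => ?; case: leP => ?; lra.
- by rewrite sumrB mu1 nu1 subrr.
- by move=> x y v; case: (eqVneq x y) => [-> _ ->|_] //; rewrite eqxx.
- by move=> x y v; case: (eqVneq x y) => [-> _ ->|_] //; rewrite eqxx.
Qed.

(* What the algorithm guarantees about the amount m that it moves from a to b;
   by the last condition, some xi or some excess becomes 0. *)
Record movable s a b m : Prop := Movable {
  movable_gt0 : 0 < m;
  movable_src : m <= xi s a;
  movable_dst : m <= - xi s b;
  movable_up : forall v, below a v -> ~~ below b v -> m <= excess s v;
  movable_down : forall v, below b v -> ~~ below a v -> m <= - excess s v;
  movable_tight : [\/ m = xi s a, m = - xi s b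
    | exists v, below a v /\ ~~ below b v /\ m = excess s v
             \/ below b v /\ ~~ below a v /\ m = - excess s v] }.

Lemma movable_neq s a b m : movable s a b m -> a != b.
Proof.
by case=> m0 ma mb _ _ _; apply/eqP => ab; rewrite ab in ma; lra.
Qed.

Lemma xi_move s a b m z : a != b ->
  xi (move s a b m) z = xi s z + m *+ (z == b) - m *+ (z == a).
Proof.
move=> ab /=; case: (eqVneq z a) => [->|_]; first by rewrite (negPf ab) addr0.
by case: eqVneq => _; rewrite ?subr0 ?addr0.
Qed.

Lemma excess_move s a b m v : a != b ->
  excess (move s a b m) v = excess s v + m *+ below b v - m *+ below a v.
Proof.
move=> ab; rewrite /excess (eq_bigr _ (fun z _ => xi_move s m z ab)) sumrB big_split.
have sum1 c : \sum_(z | below z v) m *+ (z == c) = m *+ below c v.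
  have [cv|ncv] := boolP (below c v).
    rewrite (bigD1 c) //= eqxx big1 ?addr0 // => z /andP[_ /negPf->].
    by rewrite mulr0n.
  by rewrite big1 // => z; case: eqVneq => [->|_]; rewrite ?(negPf ncv) ?mulr0n.
by rewrite /= !sum1.
Qed.

(** Only edges that separate [a] from [b] are affected, and there [m] is at most the absolute
    excess: the excess moves towards 0 without passing it. *)
Lemma excess_move_cases s a b m v : movable s a b m ->
  [\/ excess (move s a b m) v = excess s v,
      excess (move s a b m) v = excess s v - m /\ m <= excess s v
    | excess (move s a b m) v = excess s v + m /\ m <= - excess s v].
Proof.
move=> mv; have ab := movable_neq mv; case: mv => _ _ _ mup mdown _.
rewrite excess_move //; case: (boolP (below a v)) => av; case: (boolP (below b v)) => bv;
  rewrite ?mulr1n ?mulr0n ?addrK ?addr0 ?subr0.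
- by constructor 1.
- by constructor 2; rewrite mup.
- by constructor 3; rewrite mdown.
- by constructor 1.
Qed.

Lemma inv_move s a b m : inv s -> movable s a b m -> inv (move s a b m).
Proof.
move=> [Ipar Isupp Ige0 Ifst Isnd Isum Ipos Ineg Iout Iin] mv.
have ab := movable_neq mv; case: (mv) => m0 ma mb mup mdown _.
have plan_sum_fst z : \sum_y plan (move s a b m) z y =
    \sum_y plan s z y + m *+ (z == a).
  rewrite /=; have [->|_] /= := eqVneq z a; last by rewrite addr0.
  rewrite (bigD1 b) // [in RHS](bigD1 b) //= eqxx addrAC; congr (_ + _ + _).
  by apply: eq_bigr => y /negPf->.
have plan_sum_snd z : \sum_y plan (move s a b m) y z =
    \sum_y plan s y z + m *+ (z == b).
  rewrite /=; have [->|_] /= := eqVneq z b.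
    rewrite (bigD1 a) // [in RHS](bigD1 a) //= eqxx addrAC; congr (_ + _ + _).
    by apply: eq_bigr => y /negPf->.
  by rewrite addr0; apply: eq_bigr => y _; rewrite andbF.
have plan_move x y : plan (move s a b m) x y != 0 ->
    plan s x y != 0 \/ x = a /\ y = b.
  by rewrite /=; case: ifP => [/andP[/eqP-> /eqP->]|_]; [right | left].
have xi_ab z : [\/ z = a, z = b | xi (move s a b m) z = xi s z].
  rewrite xi_move //; case: (eqVneq z a) => [->|_]; first by constructor 1.
  case: (eqVneq z b) => [->|_]; first by constructor 2.
  by constructor 3; rewrite addr0 subr0.
have xi_a : xi (move s a b m) a = xi s a - m by rewrite /= eqxx.
have xi_b : xi (move s a b m) b = xi s b + m.
  by rewrite /= eqxx eq_sym (negPf ab).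
split; rewrite -?/(move s a b m).
- exact: Ipar.
- move=> v; case: (xi_ab v) => [->|->|->] => [_|_|/Isupp//]; apply: Isupp.
    by rewrite gt_eqF //; lra.
  by rewrite lt_eqF //; lra.
- by move=> x y /=; case: ifP => _ //; rewrite addr_ge0 // ltW.
- move=> z; rewrite plan_sum_fst Ifst.
  have [->|za] := eqVneq z a.
    by rewrite xi_a !max_l ?mulr1n; lra.
  rewrite addr0; case: (xi_ab z) => [zE|->|->//]; first by rewrite zE eqxx in za.
  by rewrite xi_b !max_r //; lra.
- move=> z; rewrite plan_sum_snd Isnd.
  have [->|zb] := eqVneq z b.
    by rewrite xi_b !max_l ?mulr1n; lra.
  rewrite addr0; case: (xi_ab z) => [->|zE|->//]; last by rewrite zE eqxx in zb.
  by rewrite xi_a !max_r //; lra.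
- rewrite -excess_root excess_move // excess_root Isum !below_root_r; lra.
- by move=> v; case: (excess_move_cases v mv) => [-> /Ipos//|[-> ?] ?|[-> ?] ?];
    apply: Ipos; lra.
- by move=> v; case: (excess_move_cases v mv) => [-> /Ineg//|[-> ?] ?|[-> ?] ?];
    apply: Ineg; lra.
(* Mass newly sent out of the subtree of [v] satisfies [0 < m <= excess s v], so [inv_pos] for the
   old state gives the sign. *)
- move=> x y v /plan_move[/Iout|[-> ->]]; first exact.
  by move=> av bv; apply: Ipos; have := mup v av bv; lra.
- move=> x y v /plan_move[/Iin|[-> ->]]; first exact.
  by move=> av bv; apply: Ineg; have := mdown v av bv; lra.
Qed.

Lemma card_nonzero_lt (f g : X -> R) c :
  [set x | g x != 0] \subset [set x | f x != 0] -> f c != 0 -> g c = 0 ->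
  (#|[set x | g x != 0%R]| < #|[set x | f x != 0%R]|)%N.
Proof.
move=> sub fc gc; apply: proper_card; apply/properP; split=> //.
by exists c; rewrite inE ?fc // gc eqxx.
Qed.

(** A transfer decreases the sum of the first two counts, since no zero becomes nonzero and some
    nonzero value vanishes; removing a vertex decreases the third. *)
Definition measure s : nat :=
  (#|[set x | xi s x != 0%R]| + #|[set v | excess s v != 0%R]| + #|cur s|)%N.

Lemma measure_move s a b m : movable s a b m -> (measure (move s a b m) < measure s)%N.
Proof.
move=> mv; have ab := movable_neq mv; case: (mv) => m0 ma mb mup mdown tight.
rewrite /measure ltn_add2r.
have xi_sub : [set x | xi (move s a b m) x != 0] \subset [set x | xi s x != 0].
  apply/subsetP => z; rewrite !inE xi_move //.
  have [->|_] := eqVneq z a; first by rewrite (gt_eqF (x := xi s a)) //; lra.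
  have [->|_] := eqVneq z b; first by rewrite (lt_eqF (x := xi s b)) //; lra.
  by rewrite addr0 subr0.
have ex_sub : [set v | excess (move s a b m) v != 0] \subset
              [set v | excess s v != 0].
  apply/subsetP => v; rewrite !inE.
  case: (excess_move_cases v mv) => [->//|[_ ?]|[_ ?]] _.
    by rewrite gt_eqF //; lra.
  by rewrite lt_eqF //; lra.
(* The case of tightness tells which count drops: that of [xi] at [a] or [b], or that of the excess
   at [v]. *)
case: tight => [mE|mE|[v [[av [bv mE]]|[bv [av mE]]]]].
- rewrite -addSn leq_add ?(subset_leq_card ex_sub) //; apply: (card_nonzero_lt (c := a) xi_sub).
    by rewrite gt_eqF // -mE.
  by rewrite xi_move // eqxx (negPf ab) mulr0n mulr1n; lra.
- rewrite -addSn leq_add ?(subset_leq_card ex_sub) //; apply: (card_nonzero_lt (c := b) xi_sub).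
    by rewrite lt_eqF //; lra.
  by rewrite xi_move // eqxx eq_sym (negPf ab) mulr0n mulr1n; lra.
- rewrite -addnS leq_add ?(subset_leq_card xi_sub) //; apply: (card_nonzero_lt (c := v) ex_sub).
    by rewrite gt_eqF // -mE.
  by rewrite excess_move // av (negPf bv) mulr0n mulr1n; lra.
- rewrite -addnS leq_add ?(subset_leq_card xi_sub) //; apply: (card_nonzero_lt (c := v) ex_sub).
    by rewrite lt_eqF //; lra.
  by rewrite excess_move // bv (negPf av) mulr0n mulr1n; lra.
Qed.

Lemma is_leafP (V : {set X}) x : reflect
  (x \in V /\ forall v, v \in V -> v != r -> parent v != x) (is_leaf T V x).
Proof.
apply: (iffP andP) => -[xV h]; split=> //.
  by move=> v vV vr; have /forall_inP/(_ v vV)/implyP := h; exact.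
by apply/forall_inP => v vV; apply/implyP; exact: h.
Qed.

(** The current tree is closed under [parent], so a current vertex strictly below [x] would have an
    ancestor in it that is a child of [x]. *)
Lemma leaf_below s x z : inv s -> is_leaf T (cur s) x ->
  z \in cur s -> below z x -> z = x.
Proof.
move=> Is /is_leafP[xV leafx]; elim/(parent_ind (T := T)): z => [|z zr IH] zV.
  by rewrite below_root_l => /eqP.
rewrite below_step // => /orP[/eqP-> //|/IH pzx].
by have := leafx z zV zr; rewrite pzx ?eqxx // (inv_parent Is).
Qed.

Lemma excess_leaf s x : inv s -> is_leaf T (cur s) x -> excess s x = xi s x.
Proof.
move=> Is leafx; rewrite /excess (bigD1 x) ?below_refl //= big1 ?addr0 //.
move=> z /andP[zx nzx]; apply/eqP; apply: contraNT nzx => xi0.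
by apply/eqP/(leaf_below Is leafx); rewrite ?(inv_supp Is).
Qed.

Lemma inv_remove s x : inv s -> is_leaf T (cur s) x -> xi s x = 0 -> inv (remove s x).
Proof.
move=> [Ipar Isupp ? ? ? ? ? ? ? ?] /is_leafP[xV leafx] x0; split=> //= v; rewrite !inE.
  move=> /andP[vx vV]; rewrite Ipar // andbT.
  by have [vr|vr] := eqVneq v r; [rewrite vr parent_root -vr | exact: leafx].
move=> xi_v; rewrite Isupp // andbT.
by apply: contraNneq xi_v => ->; rewrite x0.
Qed.

Lemma measure_remove s x : x \in cur s -> (measure (remove s x) < measure s)%N.
Proof. by move=> xV; rewrite /measure ltn_add2l [in X in (_ < X)%N](cardsD1 x) xV. Qed.

Lemma inv_trim s x y : inv s -> is_leaf T (cur s) x -> inv (trim T s x y).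
Proof.
move=> Is leafx; rewrite /trim; set s1 := if xi s x == 0 then _ else _.
have Is1 : inv s1 by rewrite /s1; case: eqP => // x0; exact: inv_remove.
by case: ifP => // /andP[/eqP y0 leafy]; exact: inv_remove.
Qed.

Lemma measure_trim s x y : is_leaf T (cur s) x -> (measure (trim T s x y) <= measure s)%N.
Proof.
move=> /is_leafP[xV _]; rewrite /trim; set s1 := if xi s x == 0 then _ else _.
have le1 : (measure s1 <= measure s)%N.
  by rewrite /s1; case: ifP => // _; rewrite ltnW // measure_remove.
case: ifP => // /andP[_ /is_leafP[yV _]].
by rewrite ltnW // (leq_trans _ le1) // measure_remove.
Qed.

Lemma Xi_excess s v : inv s -> Xi T s v = excess s v.
Proof.
move=> Is; rewrite /Xi /mass /excess big_mkcond [RHS]big_mkcond.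
apply: eq_bigr => y _; rewrite !inE andbC; case: (below y v) => //=.
by case: ifPn => //; apply: contraNeq; rewrite eq_sym; exact: inv_supp.
Qed.

(** Comparisons of signs become inequalities on quantities multiplied by the sign of [xi s x], so
    that both signs of the leaf are treated at once. *)
Lemma sgr_eq_sign (t c : R) : t != 0 -> (Num.sg c == Num.sg t) = (0 < Num.sg t * c).
Proof.
by case: (sgrP t) => // _ _; rewrite ?mul1r ?mulN1r ?sgr_cp0 ?oppr_gt0.
Qed.

Lemma sgr_eqN_sign (t c : R) : t != 0 -> (Num.sg c == - Num.sg t) = (Num.sg t * c < 0).
Proof. by move=> t0; rewrite -eqr_oppLR -sgrN sgr_eq_sign // mulrN oppr_gt0. Qed.

Lemma normr_sign (t c : R) : 0 < Num.sg t * c -> `|c| = Num.sg t * c.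
Proof.
case: sgrP => _; rewrite ?mul0r ?ltxx // ?mul1r ?mulN1r => c0; first exact: gtr0_norm.
by rewrite ltr0_norm // -oppr_gt0.
Qed.

(** * The climb from a leaf, the existence of a partner, and the amount moved *)

Section Partner.
Variables (s : state R X) (x : X).
Hypothesis Is : inv s.
Hypothesis x0 : xi s x != 0.
Local Notation sgn := (Num.sg (xi s x)).

Lemma candidatesP u y : reflect
  [/\ below y u, sgn * xi s y < 0
    & forall v, below y v -> ~~ below u v -> sgn * excess s v < 0]
  (y \in candidates T s x u).
Proof.
rewrite !inE; apply: (iffP idP).
  move=> /andP[/andP[_ yu] /and3P[sg_neq y0 /forall_inP lower]]; split=> //.
    rewrite lt_neqAle mulf_neq0 ?sgr_eq0 //= leNgt -sgr_eq_sign //.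
    by rewrite eq_sym.
  move=> v yv uv; rewrite -sgr_eqN_sign // -Xi_excess //; apply: lower.
  by rewrite lower_ends_below // yv.
move=> [yu xi_y lower]; have y0 : xi s y != 0.
  by apply: contraTneq xi_y => ->; rewrite mulr0 ltxx.
rewrite (inv_supp Is) // yu y0 /= eq_sym sgr_eq_sign // -leNgt ltW //=.
apply/forall_inP => v; rewrite lower_ends_below // => /andP[yv uv].
by rewrite Xi_excess // sgr_eqN_sign // lower.
Qed.

(* y is a deepest vertex among those that can be reached from c through edges
   with excess of the sign opposite to xi x. *)
Lemma descend c : sgn * excess s c < 0 ->
  exists y, [/\ below y c, sgn * xi s y < 0
    & forall v, below y v -> below v c -> sgn * excess s v < 0].
Proof.
move=> exc.
pose P w := below w c && [forall v, below w v && below v c ==> (sgn * excess s v < 0)].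
have Pc : P c.
  rewrite /P below_refl; apply/forallP => v; apply/implyP => /andP[cv vc].
  by rewrite (below_antisym vc cv).
case: (arg_maxnP (depth T) Pc) => w /andP[wc /forallP hw] wmax.
have {}hw v : below w v -> below v c -> sgn * excess s v < 0.
  by move=> wv vc; have /implyP := hw v; rewrite wv vc; exact.
(* Were [xi s w] not of the opposite sign, then either some child of [w] has opposite excess and is
   a deeper choice, or [excess_rec] contradicts the sign of the excess at [w]. *)
exists w; split=> //; rewrite ltNge; apply/negP => xi_w.
have [d /andP[/andP[dr /eqP dw] exd]|none] :=
  pickP (fun d => (d != r) && (parent d == w) && (sgn * excess s d < 0)).
  have : P d.
    rewrite /P below_step // dw wc orbT; apply/forallP => v; apply/implyP.
    by rewrite below_step // dw => /andP[/orP[/eqP->//|wv] vc]; exact: hw.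
  by move/wmax; rewrite /geq /= (depth_parent dr) dw ltnn.
have := hw w (below_refl _ _) wc; rewrite excess_rec mulrDr mulr_sumr ltNge.
case/negP; rewrite addr_ge0 // sumr_ge0 // => d dP.
by rewrite leNgt; have := none d; rewrite dP /= => ->.
Qed.

(** The child [um] contributes excess of the sign of [xi s x], yet the total at [u] does not have
    this sign. By [excess_rec], either [u] has the opposite sign and is a partner, or another child
    has opposite excess and [descend] finds a partner below it. *)
Lemma partner_exists u um : um != r -> parent um = u ->
  0 < sgn * excess s um -> sgn * excess s u <= 0 ->
  candidates T s x u != set0.
Proof.
move=> umr umu exum exu; apply/set0Pn.
have [xi_u|xi_u] := ltP (sgn * xi s u) 0.
  exists u; apply/candidatesP; split=> // [|v ->//]; exact: below_refl.
have [d /andP[/andP[dr /eqP du] exd]|none] :=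
  pickP (fun d => (d != r) && (parent d == u) && (sgn * excess s d < 0)).
  have [y [yd xi_y lower]] := descend exd; exists y; apply/candidatesP; split=> //.
    by rewrite (below_trans yd) // -du below_parent.
  move=> v yv uv; apply: lower => //.
  have /orP[|//] := below_total yd yv; rewrite below_step // du (negPf uv) orbF.
  by move/eqP->; exact: below_refl.
have := exu; rewrite excess_rec (bigD1 um) ?umr ?umu ?eqxx //= !mulrDr; set rest := \sum_(i | _) _.
suff : 0 <= sgn * rest by lra.
rewrite mulr_sumr; apply: sumr_ge0 => d /andP[dP _]; rewrite leNgt; have := none d.
by rewrite dP /= => ->.
Qed.

(** The loop invariant of the climb: [m] is the minimum of [|xi s x|] and of the absolute excesses
    on the edges climbed, all of which have the sign of [xi s x]. That this minimum is attained will
    give [movable_tight]. *)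
Record climbing m um u : Prop := Climbing {
  climbing_gt0 : 0 < m;
  climbing_root : um != r;
  climbing_parent : parent um = u;
  climbing_below : below x um;
  climbing_up : forall v, below x v -> below v um -> m <= sgn * excess s v;
  climbing_src : m <= sgn * xi s x;
  climbing_tight : m = sgn * xi s x
    \/ exists v, [/\ below x v, below v um & m = sgn * excess s v] }.

Lemma climbing_start : is_leaf T (cur s) x -> climbing `|xi s x| x (parent x).
Proof.
move=> leafx; have xE : sgn * xi s x = `|xi s x| by rewrite normrEsg.
split=> //; rewrite ?normr_gt0 ?xE //; last by left.
- apply: contraNneq x0 => xr.
  by rewrite -(excess_leaf Is leafx) xr excess_root (inv_sum Is).
- exact: below_refl.
- by move=> v xv vx; rewrite (below_antisym vx xv) (excess_leaf Is) // xE.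
Qed.

Lemma climbing_next m um u : climbing m um u -> climbs T s x um u ->
  climbing (Num.min m `|Xi T s u|) u (parent u).
Proof.
move=> [m0 umr umu xum up src tight] go.
have exum : 0 < sgn * excess s um by have := up um xum (below_refl _ _); lra.
(* Either the test says that the signed excess grows from [um] to [u], or there is no candidate and
   [partner_exists] excludes a nonpositive excess. *)
have exu : 0 < sgn * excess s u.
  case/orP: go => [/andP[+ _]|/eqP none].
    by rewrite sgr_eq_sign // !Xi_excess // mulrBr; lra.
  by rewrite ltNge; apply/negP => /(partner_exists umr umu exum); rewrite none eqxx.
rewrite Xi_excess // (normr_sign exu); split=> //.
- by rewrite lt_min m0.
(* The excess at the root is the total of [xi], which is 0. *)
- by apply: contraTneq exu => ->; rewrite excess_root (inv_sum Is) mulr0 ltxx.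
- by rewrite (below_trans xum) // -umu below_parent.
- move=> v xv vu; rewrite ge_min.
  have /orP[umv|vum] := below_total xum xv; last by rewrite up.
  have := umv; rewrite below_step // umu => /orP[/eqP->|uv].
    by rewrite up // below_refl.
  by rewrite (below_antisym vu uv) lexx orbT.
- by rewrite ge_min src.
- rewrite minEle; case: ifP => _; last first.
    by right; exists u; split; rewrite ?below_refl // (below_trans xum) // -umu below_parent.
  case: tight => [|[v [xv vum mE]]]; [by left | right; exists v; split=> //].
  by rewrite (below_trans vum) // -umu below_parent.
Qed.

Lemma amount_le m u y : amount T s m u y <= m.
Proof. by apply: le_trans (bigmin_le_id _ _ _ _) _; rewrite ge_min lexx. Qed.

Lemma amount_le_xi m u y : amount T s m u y <= `|xi s y|.
Proof. by apply: le_trans (bigmin_le_id _ _ _ _) _; rewrite ge_min lexx orbT. Qed.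

Lemma amount_le_Xi m u y v :
  v \in lower_ends T u y -> amount T s m u y <= `|Xi T s v|.
Proof. exact: bigmin_le_cond. Qed.

Lemma amount_eq m u y :
  [\/ amount T s m u y = m, amount T s m u y = `|xi s y|
    | exists2 v, v \in lower_ends T u y & amount T s m u y = `|Xi T s v|].
Proof.
rewrite /amount; elim/big_rec: _ => [|v a vP IH].
  by rewrite minEle; case: ifP => _; [constructor 1 | constructor 2].
by rewrite minEle; case: ifP => _ //; constructor 3; exists v.
Qed.

(** The edges between [x] and [y] are those climbed, from [x] up to [um], and those descended, from
    [u] to [y]; [climbing] bounds the amount on the former and [amount] on the latter. *)
Lemma climbing_movable m um u y :
  climbing m um u -> y \in candidates T s x u ->
  let a := amount T s m u y in
  if 0 < xi s x then movable s x y a else movable s y x a.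
Proof.
move=> [m0 umr umu xum up src tight] /candidatesP[yu xi_y lower] a.
have exum : 0 < sgn * excess s um by have := up um xum (below_refl _ _); lra.
have xu : below x u by rewrite (below_trans xum) // -umu below_parent.
have u_um : ~~ below u um by rewrite -umu parent_not_below.
(* Otherwise the path from [u] to [y] would descend through [um], whose excess has the sign of
   [xi s x]. *)
have y_um : ~~ below y um.
  by apply/negP => yum; have := lower um yum u_um; lra.
have normN c : sgn * c < 0 -> `|c| = - (sgn * c).
  by move=> c0; rewrite -normrN (normr_sign (t := xi s x)) mulrN // oppr_gt0.
have norm_xi_y := normN _ xi_y.
have norm_Xi v : below y v -> ~~ below u v -> `|Xi T s v| = - (sgn * excess s v).
  by move=> yv uv; rewrite Xi_excess // normN // lower.
have lowerE v := lower_ends_below v yu.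
(* An ancestor [v] of [x] that is not above [u] is below [um] and has excess of the wrong sign, or
   is [um] itself, which is not above [y]. *)
have x_lower v : below y v -> ~~ below u v -> ~~ below x v.
  move=> yv uv; apply/negP => xv; have exv := lower v yv uv.
  have /orP[umv|vum] := below_total xum xv; last by have := up v xv vum; lra.
  move: umv; rewrite below_step // umu (negPf uv) orbF => /eqP vum.
  by rewrite -vum yv in y_um.
have y_climb v : below v um -> ~~ below y v.
  by move=> vum; apply: contraNN y_um => yv; exact: below_trans yv vum.
have a_gt0 : 0 < a.
  rewrite /a; have [->|->|[v]] := amount_eq m u y; rewrite ?norm_xi_y ?oppr_gt0 //.
  rewrite lowerE => /andP[yv uv] ->; rewrite norm_Xi //.
  by have := lower v yv uv; lra.
have a_src : a <= sgn * xi s x by rewrite (le_trans (amount_le m u y)).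
have a_dst : a <= - (sgn * xi s y) by rewrite -norm_xi_y amount_le_xi.
have a_up v : below x v -> ~~ below y v -> a <= sgn * excess s v.
  move=> xv yv; rewrite (le_trans (amount_le m u y)) // up //.
  have /orP[umv|//] := below_total xum xv.
  move: umv; rewrite below_step // => /orP[/eqP->|]; first exact: below_refl.
  by rewrite umu => uv; rewrite (below_trans yu uv) in yv.
have a_down v : below y v -> ~~ below x v -> a <= - (sgn * excess s v).
  move=> yv xv; have uv : ~~ below u v by apply: contraNN xv; exact: below_trans.
  by rewrite -norm_Xi // amount_le_Xi // lowerE yv.
have a_tight : [\/ a = sgn * xi s x, a = - (sgn * xi s y)
    | exists v, below x v /\ ~~ below y v /\ a = sgn * excess s v
             \/ below y v /\ ~~ below x v /\ a = - (sgn * excess s v)].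
  have [aE|aE|[v vlow aE]] := amount_eq m u y; rewrite -/a in aE.
  - case: tight => [mE|[v [xv vum mE]]]; first by constructor 1; rewrite aE.
    by constructor 3; exists v; left; rewrite aE; split=> //; split=> //; exact: y_climb.
  - by constructor 2; rewrite aE.
  - move: vlow; rewrite lowerE => /andP[yv uv].
    by constructor 3; exists v; right; rewrite aE norm_Xi //; split=> //; split=> //; exact: x_lower.
case: ifPn => xi_x.
  have sgnE c : sgn * c = c by rewrite gtr0_sg // mul1r.
  rewrite !sgnE in a_src a_dst a_tight; split=> //.
  - by move=> v xv yv; rewrite -(sgnE (excess s v)) a_up.
  - by move=> v yv xv; rewrite -(sgnE (excess s v)) a_down.
  case: a_tight => [aE|aE|[v]]; [by constructor 1 | by constructor 2 |].
  by rewrite sgnE; constructor 3; exists v.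
(* For negative [xi s x] the leaf receives mass, so source and destination, climb and descent,
   exchange roles. *)
have sgnE c : sgn * c = - c.
  by rewrite ltr0_sg ?mulN1r // lt_neqAle x0 leNgt.
rewrite !sgnE !opprK in a_src a_dst a_tight; split=> //.
- by move=> v yv xv; rewrite -[excess s v]opprK -(sgnE (excess s v)) a_down.
- by move=> v xv yv; rewrite -(sgnE (excess s v)) a_up.
case: a_tight => [aE|aE|[v]]; [by constructor 2 | by constructor 1 |].
by rewrite sgnE opprK => -[h|h]; constructor 3; exists v; [right | left].
Qed.

Lemma climb_climbing m um u m' u' : climb T s x m um u m' u' ->
  climbing m um u -> exists um', climbing m' um' u'.
Proof.
elim=> [{}m {}um {}u _ cl|{}m {}um {}u {}m' {}u' go _ IH cl]; first by exists um.
by apply: IH; exact: climbing_next go.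
Qed.

Lemma climb_ends m um u : climbing m um u ->
  exists m' u', climb T s x m um u m' u' /\ candidates T s x u' != set0.
Proof.
have stop m0 um0 u0 : ~~ climbs T s x um0 u0 ->
    exists m' u', climb T s x m0 um0 u0 m' u' /\ candidates T s x u' != set0.
  move=> nclimb; exists m0, u0; split; first exact: climb_exit.
  by case/norP: nclimb.
elim/(parent_ind (T := T)): u m um => [|u ur IH] m um cl.
  (* Climbing on from the root would give a [climbing] state whose [um] is the root, which
     [climbing_root] forbids. *)
  apply: stop; apply/negP => go.
  by have := climbing_root (climbing_next cl go); rewrite eqxx.
have [go|] := boolP (climbs T s x um u); last exact: stop.
have [m' [u' [cl' ne]]] := IH _ _ (climbing_next cl go).
by exists m', u'; split=> //; exact: climb_up.
Qed.

Lemma nearest_exists u : candidates T s x u != set0 -> exists y, nearest T s x u y.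
Proof.
case/set0Pn => y0 y0P; case: (arg_minP (tdist T u) y0P) => y yP ymin.
by exists y.
Qed.

Lemma step_transport_exists : is_leaf T (cur s) x -> exists s', step T s s'.
Proof.
move=> leafx; have [m [u [cl /nearest_exists[y near]]]] := climb_ends (climbing_start leafx).
by exists (trim T (transfer s x y (amount T s m u y)) x y); exact: step_transport cl near.
Qed.
End Partner.

(** * Preservation of the invariant, progress and termination *)

Lemma step_inv s s' : inv s -> step T s s' -> inv s' /\ (measure s' < measure s)%N.
Proof.
move=> Is; case=> [x m u y leafx x0 cl [yP _]|x allz leafx]; last first.
  split; first by apply: inv_remove => //; exact: allz.
  by apply: measure_remove; case/is_leafP: leafx.
have [um cl'] := climb_climbing Is x0 cl (climbing_start Is x0 leafx).
have := climbing_movable Is x0 cl' yP; rewrite /transfer.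
case: ifP => _ mv; split.
- by apply: inv_trim; [exact: inv_move | exact: leafx].
- apply: leq_ltn_trans (measure_move mv); exact: measure_trim.
- by apply: inv_trim; [exact: inv_move | exact: leafx].
- apply: leq_ltn_trans (measure_move mv); exact: measure_trim.
Qed.

Lemma step_exists s : inv s -> halted T s \/ exists s', step T s s'.
Proof.
move=> Is.
have [x /andP[leafx x0]|none] := pickP (fun x => is_leaf T (cur s) x && (xi s x != 0)).
  by right; exact: step_transport_exists x0 leafx.
have [x leafx|noleaf] := pickP (is_leaf T (cur s)); last first.
  by left=> x; rewrite noleaf.
right; exists (remove s x); apply: step_discard => // z leafz.
by have := none z; rewrite leafz /= => /negbFE/eqP.
Qed.

(** A deepest vertex of a nonempty vertex set is a leaf. *)
Lemma halted_cur s : halted T s -> cur s = set0.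
Proof.
move=> halt; apply/eqP/set0Pn => -[v0 v0V].
case: (arg_maxnP (depth T) v0V) => v vV vmax; case/negP: (halt v); apply/is_leafP.
split=> // w wV wr; apply: contraTneq (vmax w wV) => <-.
by rewrite /geq /= (depth_parent wr) ltnn.
Qed.

Lemma inv_acc s : inv s -> Acc (fun s' s => step T s s') s.
Proof.
move: {2}(measure s) (leqnn (measure s)) => n.
elim: n s => [|n IH] s le_n Is; constructor=> s' /(step_inv Is)[Is' lt_s].
  by have := leq_trans lt_s le_n; rewrite ltn0.
by apply: IH Is'; rewrite -ltnS (leq_trans lt_s le_n).
Qed.

Lemma reachable_inv s : is_prob mu -> is_prob nu -> reachable T mu nu s -> inv s.
Proof.
move=> mu_prob nu_prob; elim=> [|{}s s' _ Is /(step_inv Is)[]//]; exact: inv_init.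
Qed.

Lemma run_terminates : is_prob mu -> is_prob nu -> always_terminates T mu nu.
Proof.
move=> mu_prob nu_prob; split; first exact/inv_acc/inv_init.
by move=> s /(reachable_inv mu_prob nu_prob); exact: step_exists.
Qed.
End Run.

(** * Optimality of the output and its crossing masses *)

Lemma coupling_of_marginals (R : realFieldType) (X : finType) (mu nu : X -> R) g :
  is_prob mu -> (forall x y, 0 <= g x y) ->
  (forall x, \sum_y g x y = mu x) -> (forall y, \sum_x g x y = nu y) ->
  coupling mu nu g.
Proof.
move=> [_ mu1] g0 gmu gnu; split=> //; split=> [[x y]|] //=.
by rewrite -(pair_big xpredT xpredT g) -mu1; apply: eq_bigr => x _; exact: gmu.
Qed.

Lemma flow_eq0 (R : realFieldType) (X : finType) (g : X -> X -> R) (S S' : {set X}) :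
  (forall x y, x \in S -> y \in S' -> g x y = 0) -> flow g S S' = 0.
Proof. by move=> g0; apply: big1 => x xS; apply: big1 => y yS'; exact: g0. Qed.

Theorem proposition4p3 (R : realFieldType) (X : finType) (T : wtree R X)
    (mu nu : X -> R) (hmu : is_prob mu) (hnu : is_prob nu) :
  always_terminates T mu nu /\
  forall gamma : X -> X -> R, tree_transport_output T mu nu gamma ->
    optimal_plan (tdist T) mu nu gamma /\
    forall u : X, u != tree_root T ->
      (0 < mass mu (subtree T u) - mass nu (subtree T u) ->
         \sum_(x in subtree T u) \sum_(y in ~: subtree T u) gamma x y
           = mass mu (subtree T u) - mass nu (subtree T u) /\
         \sum_(x in ~: subtree T u) \sum_(y in subtree T u) gamma x y = 0) /\
      (mass mu (subtree T u) - mass nu (subtree T u) < 0 ->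
         \sum_(x in subtree T u) \sum_(y in ~: subtree T u) gamma x y = 0 /\
         \sum_(x in ~: subtree T u) \sum_(y in subtree T u) gamma x y
           = mass nu (subtree T u) - mass mu (subtree T u)).
Proof.
split; first exact: run_terminates.
move=> gamma [s [run halt ->]].
have [_ supp g0 gmu gnu _ _ _ gout gin] := reachable_inv hmu hnu run.
have xi0 v : xi s v = 0.
  by apply/eqP; apply: contraT => /supp; rewrite (halted_cur halt) inE.
have {}gmu x : \sum_y plan s x y = mu x by rewrite gmu xi0 maxxx subr0.
have {}gnu y : \sum_x plan s x y = nu y by rewrite gnu xi0 oppr0 maxxx subr0.
(* The inequalities here and in [in0] are weak so that an edge with zero imbalance is covered
   too. *)
have out0 v : mass mu (subtree T v) - mass nu (subtree T v) <= 0 ->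
    flow (plan s) (subtree T v) (~: subtree T v) = 0.
  rewrite -(excess_init T) leNgt => /negP npos; apply: flow_eq0 => x y; rewrite !inE => xv yv.
  by apply/eqP; apply: contraT => /gout/(_ xv yv).
have in0 v : 0 <= mass mu (subtree T v) - mass nu (subtree T v) ->
    flow (plan s) (~: subtree T v) (subtree T v) = 0.
  rewrite -(excess_init T) leNgt => /negP nneg; apply: flow_eq0 => x y; rewrite !inE => xv yv.
  by apply/eqP; apply: contraT => /gin/(_ yv xv).
split.
  apply: one_way_optimal; first exact: coupling_of_marginals.
  move=> v _; have [/ltW|] := ltP 0 (mass mu (subtree T v) - mass nu (subtree T v)).
    by move/in0; right.
  by move/out0; left.
move=> u _; rewrite -!/(flow _ _ _); have := flow_balance (subtree T u) gmu gnu.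
have o0 := out0 u; have i0 := in0 u; move=> bal.
split=> D0; [have {}i0 := i0 (ltW D0) | have {}o0 := o0 (ltW D0)]; split=> //; lra.
Qed.
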